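(* Let $X=(X(t))_{t\in\mathbb R}$ be a wide sense stationary random process with covariance function $R_X$ and symmetric spectral measure $\mu$, and let $0<\alpha<1$. Then the following are equivalent: (i) $\int_{\mathbb R}|\lambda|^{2\alpha}\,d\mu(\lambda)<\infty$; (ii) $\int_{\mathbb R}|R_X(0)-R_X(h)|\,\frac{dh}{|h|^{1+2\alpha}}<\infty$.
   Context: A wide sense stationary random process $X=(X(t))_{t\in\mathbb R}\subset L^2(\Omega,\mathcal F,\mathbf P)$ satisfies $\mathbf E X(t)=0$, $\mathbf E(X(t)\overline{X(s)})=R_X(t-s)$ for all $t,s$, and $\lim_{t\to0}\mathbf E|X(t)-X(0)|^2=0$. By Bochner's theorem $R_X(\tau)=\int_{\mathbb R}e^{i\lambda\tau}\,d\mu(\lambda)$ for a finite Borel measure $\mu$ (the spectral measure); symmetric means $\mu(-A)=\mu(A)$ for Borel $A$. *)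

(* Defs.v *)
From HB Require Import structures.
From mathcomp Require Import all_boot all_order all_algebra.
From mathcomp Require Import all_classical all_reals all_analysis.
Set Implicit Arguments. Unset Strict Implicit. Unset Printing Implicit Defensive.
Import Order.TTheory GRing.Theory Num.Theory.
Import numFieldNormedType.Exports.
Local Open Scope classical_set_scope.
Local Open Scope ring_scope.

(* A complex-valued process X(t) = Xre t + i Xim t on the probability space
   (Omega, P), indexed by t : R.  A complex-valued function Rre + i Rim is the
   covariance function. *)

Definition L2_complex_rv {d} {Omega : measurableType d} {R : realType}
  (P : probability Omega R) (fr fi : Omega -> R) : Prop :=
  [/\ measurable_fun setT fr, measurable_fun setT fi,
      P.-integrable setT (fun w => (fr w ^+ 2)%:E)
    & P.-integrable setT (fun w => (fi w ^+ 2)%:E)].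

(* Wide sense stationary process with covariance function R_X = Rre + i Rim:
   E X(t) = 0, E (X(t) conj(X(s))) = R_X(t - s), and mean-square continuity
   at 0: E |X(t) - X(0)|^2 -> 0 as t -> 0. *)
Definition wss_process {d} {Omega : measurableType d} {R : realType}
  (P : probability Omega R) (Xre Xim : R -> Omega -> R) (Rre Rim : R -> R)
  : Prop :=
  [/\ (forall t, L2_complex_rv P (Xre t) (Xim t)),
      (forall t, (\int[P]_w (Xre t w)%:E = 0)%E /\ (\int[P]_w (Xim t w)%:E = 0)%E),
      (forall t s,
         (\int[P]_w (Xre t w * Xre s w + Xim t w * Xim s w)%:E = (Rre (t - s))%:E)%E
      /\ (\int[P]_w (Xim t w * Xre s w - Xre t w * Xim s w)%:E = (Rim (t - s))%:E)%E)
    & (fun t => (\int[P]_w ((Xre t w - Xre 0 w) ^+ 2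
                          + (Xim t w - Xim 0 w) ^+ 2)%:E)%E) t @[t --> 0]
        --> 0%E].

(* mu is the spectral measure of R_X = Rre + i Rim (Bochner):
   R_X(tau) = \int e^{i lambda tau} dmu(lambda). *)
Definition spectral_measure_of {R : realType}
  (mu : {finite_measure set R -> \bar R}) (Rre Rim : R -> R) : Prop :=
  forall tau : R,
    ((Rre tau)%:E = \int[mu]_(l in setT) (cos (l * tau))%:E)%E /\
    ((Rim tau)%:E = \int[mu]_(l in setT) (sin (l * tau))%:E)%E.

Definition symmetric_measure {R : realType}
  (mu : {finite_measure set R -> \bar R}) : Prop :=
  forall A : set R, measurable A -> mu [set - x | x in A] = mu A.

(* Main.v *)
Require Import Defs.
From HB Require Import structures.
From mathcomp Require Import all_boot all_order all_algebra.
From mathcomp Require Import all_classical all_reals all_analysis.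
From mathcomp Require Import measurable_realfun real_interval ring lra.
Import Order.TTheory GRing.Theory Num.Theory.
Import numFieldNormedType.Exports.
Local Open Scope classical_set_scope.
Local Open Scope ring_scope.

(* By symmetry of [mu] the covariance is real, and
   [R_X 0 - R_X h = \int (1 - cos (l h)) dmu(l) >= 0].  By Tonelli the integral
   in (ii) is then [\int K(l) dmu(l)] with
   [K(l) = \int (1 - cos (l h)) / |h| ^ (1 + 2 alpha) dh].  Since
   [1 - cos x <= min (x ^ 2) 2] and [1 - cos] is bounded below by a positive
   constant on [[1/2, 1]], [K(l)] is comparable to [|l| ^ (2 alpha)], uniformly
   in [l]. *)

(** * Elementary bounds on [1 - cos] *)

Section cosine_bounds.
Context {R : realType}.
Implicit Types x : R.

Lemma sin_le_id x : 0 <= x -> sin x <= x.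
Proof.
move=> x0.
have [c _] := @MVT_segment R sin cos 0 x x0 (fun y _ => is_derive_sin y)
  (continuous_subspaceT (@continuous_sin R)).
rewrite sin0 !subr0 => ->.
by rewrite -[leRHS]mul1r ler_wpM2r// cos_le1.
Qed.

(** Since [cos] is even, take [y = |x|]. The mean value theorem gives [1 - cos y = y * sin c] with
    [0 <= c <= y], and [sin c <= c <= y]. *)
Lemma onem_cos_le_sqr x : 1 - cos x <= x ^+ 2.
Proof.
rewrite -cos_norm -real_normK ?num_real//.
have x0 := normr_ge0 x; set y := `|x| in x0 *.
have [c /[!in_itv]/= /andP[c0 cy]] :=
  @MVT_segment R cos (fun z => - sin z) 0 y x0 (fun z _ => is_derive_cos z)
  (continuous_subspaceT (@continuous_cos R)).
rewrite cos0 subr0 => /eqP; rewrite subr_eq => /eqP ->.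
rewrite opprD mulNr opprK addrCA subrr addr0 expr2 ler_wpM2r//.
by rewrite (le_trans (sin_le_id _ c0)).
Qed.

Lemma onem_cos_ge0 x : 0 <= 1 - cos x.
Proof. by rewrite subr_ge0 cos_le1. Qed.

Lemma onem_cos_le2 x : 1 - cos x <= 2.
Proof. by have := cos_geN1 x; lra. Qed.

Lemma onem_cos_half_gt0 : 0 < 1 - cos (2^-1 : R).
Proof.
have pi2 := @pi_ge2 R.
have hpi : 0 <= (2^-1 : R) <= pi by apply/andP; split; lra.
by rewrite subr_gt0 -[ltRHS]cos0 ltr_cos ?in_itv/= ?lexx ?pi_ge0//; lra.
Qed.

(** [cos] decreases on [[0, pi]], and [pi >= 2] places [[1/2, 1]] inside that interval. *)
Lemma onem_cos_ge x : 2^-1 <= x <= 1 -> 1 - cos (2^-1 : R) <= 1 - cos x.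
Proof.
move=> /andP[x1 x2]; have pi2 := @pi_ge2 R.
have hpi : 0 <= (2^-1 : R) <= pi by apply/andP; split; lra.
have xpi : 0 <= x <= pi by apply/andP; split; lra.
by rewrite lerD2l lerN2 leNgt ltr_cos -?leNgt ?in_itv.
Qed.

End cosine_bounds.

(** * Integrals of powers near 0 and near infinity *)

Section powR_integrals.
Context {R : realType}.
Local Notation mu := (@lebesgue_measure R).
Implicit Types a b c q : R.

(** Fundamental theorem of calculus with the primitive [x ^ q / q], smooth on [[a, b]] because
    [a > 0]. *)
Lemma integral_powR a b q : 0 < a -> a < b -> q != 0 ->
  (\int[mu]_(x in `[a, b]) (x `^ (q - 1))%:E = ((b `^ q - a `^ q) / q)%:E)%E.
Proof.
move=> a0 ab q0.
have cpow (p x : R) : 0 < x -> {for x, continuous (fun y : R => y `^ p)}.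
  move=> x0; apply: differentiable_continuous; apply/derivable1_diffP.
  by apply: derivable_powR; rewrite in_itv/= x0.
have dF (x : R) : 0 < x -> is_derive x 1 (fun y => q^-1 * y `^ q) (x `^ (q - 1)).
  move=> x0; have dpow := is_derive1_powR q x0.
  have := is_deriveZ q^-1 dpow.
  by rewrite /GRing.scale/= mulrA mulVf// mul1r.
have cF (x : R) : 0 < x -> {for x, continuous (fun y : R => q^-1 * y `^ q)}.
  by move=> x0; apply: cvgM; [exact: cvg_cst|exact: cpow].
rewrite (@continuous_FTC2 _ _ (fun y => q^-1 * y `^ q))//.
- by rewrite -EFinB -mulrBr mulrC.
- apply: continuous_in_subspaceT => x /[!inE]/= /[!in_itv]/= /andP[ax _].
  by apply: cpow; exact: lt_le_trans ax.
- split.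
  + by move=> x /[!in_itv]/= /andP[ax _]; apply: ex_derive; apply: dF; exact: lt_trans ax.
  + by apply: cvg_at_right_filter; exact: cF.
  + by apply: cvg_at_left_filter; apply: cF; exact: lt_trans ab.
- move=> x /[!in_itv]/= /andP[ax _]; rewrite derive1E.
  by have [] := dF x (lt_trans a0 ax).
Qed.

(** By monotone convergence a uniform bound on an exhausting sequence passes to the union. This
    turns bounds on compact intervals into bounds on improper integrals. *)
Lemma ge0_integral_bigcup_le (F : (set R)^nat) (f : R -> R) (M : R) :
  nondecreasing_seq F -> (forall n, measurable (F n)) ->
  measurable_fun setT f -> (forall x, 0 <= f x) ->
  (forall n, \int[mu]_(x in F n) (f x)%:E <= M%:E)%E ->
  (\int[mu]_(x in \bigcup_n F n) (f x)%:E <= M%:E)%E.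
Proof.
move=> ndF mF mf f0 fM.
have cv : (\int[mu]_(x in F n) (f x)%:E @[n --> \oo] -->
    \int[mu]_(x in \bigcup_n F n) (f x)%:E)%E.
  apply: ge0_nondecreasing_set_cvg_integral => //.
  - by move=> n; apply/measurable_EFinP; exact: measurable_funTS.
  - by move=> n x _; rewrite lee_fin.
rewrite -(cvg_lim _ cv)//; apply: lime_le; first by apply/cvg_ex; eexists; exact: cv.
exact: nearW.
Qed.

Lemma integral_powR_near0_le c q : 0 < c -> 0 < q ->
  (\int[mu]_(x in `]0%R, c]) (x `^ (q - 1))%:E <= (c `^ q / q)%:E)%E.
Proof.
move=> c0 q0.
rewrite itv_open_bnd_bigcup; apply: ge0_integral_bigcup_le => //.
- move=> m n mn; apply/subsetPset; apply: subset_itvr.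
  by rewrite bnd_simp lerD2l lef_pV2 ?posrE// ler_nat.
- by move=> x; exact: powR_ge0.
- move=> n; rewrite add0r.
  have n0 : 0 < n.+1%:R^-1 :> R by rewrite invr_gt0.
  (* The exhausting interval [[1/(n+1), c]] is nondegenerate, a single point, or empty when [n] is
     small; only the first case needs the primitive. *)
  have [nc|] := ltP n.+1%:R^-1 c.
    rewrite integral_powR ?gt_eqF// lee_fin ler_wpM2r ?invr_ge0 ?(ltW q0)//.
    by rewrite lerBlDr lerDl powR_ge0.
  rewrite le_eqVlt => /orP[/eqP <-|cn].
    by rewrite set_itv1 integral_set1 lee_fin divr_ge0 ?powR_ge0 ?(ltW q0).
  rewrite set_itv_ge ?bnd_simp -?ltNge// integral_set0 lee_fin.
  by rewrite divr_ge0 ?powR_ge0 ?(ltW q0).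
Qed.

Lemma integral_powR_tail_le c q : 0 < c -> 0 < q ->
  (\int[mu]_(x in `[c, +oo[) (x `^ (- q - 1))%:E <= (c `^ (- q) / q)%:E)%E.
Proof.
move=> c0 q0.
rewrite itv_bndy_bigcup_BRight; apply: ge0_integral_bigcup_le => //.
- move=> m n mn; apply/subsetPset; apply: subset_itvl.
  by rewrite bnd_simp lerD2l ler_nat.
- by move=> x; exact: powR_ge0.
(* The first exhausting interval [[c, c + 0]] is a point and has to be treated apart. *)
- case=> [|n].
    by rewrite addr0 set_itv1 integral_set1 lee_fin divr_ge0 ?powR_ge0 ?(ltW q0).
  rewrite integral_powR ?oppr_eq0 ?gt_eqF// ?ltrDl// lee_fin.
  rewrite invrN mulrN -mulNr ler_wpM2r ?invr_ge0 ?(ltW q0)//.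
  by rewrite opprB lerBlDr lerDl powR_ge0.
Qed.

End powR_integrals.

(** * The kernel [K(l)] and its comparison with [|l| ^ (2 a)] *)

Section fractional_kernel.
Context {R : realType}.
Local Notation mu := (@lebesgue_measure R).
Implicit Types l h a : R.

(** The integrand of [K(l)]. At [h = 0] the numerator vanishes, so the value there is 0. *)
Definition frac_kernel a l h : R := (1 - cos (l * h)) / `|h| `^ (1 + 2 * a).

Lemma frac_kernel_ge0 a l h : 0 <= frac_kernel a l h.
Proof. by rewrite divr_ge0 ?onem_cos_ge0 ?powR_ge0. Qed.

(** Joint measurability in the pair [(h, l)], in this order, as Tonelli's theorem will require. *)
Lemma measurable_frac_kernel a :
  measurable_fun setT (fun z : R * R => frac_kernel a z.2 z.1).
Proof.
apply: measurable_funM.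
  apply: measurable_funB => //; apply: measurableT_comp.
    exact: continuous_measurable_fun (@continuous_cos R).
  exact: measurable_funM.
rewrite (_ : (fun _ => _) = (fun z : R * R => `|z.1| `^ (- (1 + 2 * a)))); last first.
  by apply/funext => z; rewrite powRN.
apply: (measurableT_comp (@measurable_powR R (- (1 + 2 * a)))).
exact: measurableT_comp.
Qed.

Lemma measurable_frac_kernelr a l : measurable_fun setT (frac_kernel a l).
Proof.
exact: (measurableT_comp (measurable_frac_kernel a) (measurable_pair2 l)).
Qed.

Lemma frac_kernelN a l h : frac_kernel a l (- h) = frac_kernel a l h.
Proof. by rewrite /frac_kernel mulrN cosN normrN. Qed.

Lemma frac_kernel_norm a l h : frac_kernel a `|l| h = frac_kernel a l h.
Proof.
rewrite /frac_kernel -(cos_norm (l * h)) normrM -(cos_norm (`|l| * h)).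
by rewrite normrM normr_id.
Qed.

Lemma integral_frac_kernel_le_half a l c :
  (\int[mu]_(h in `]0%R, +oo[) (frac_kernel a l h)%:E <= c%:E)%E ->
  (\int[mu]_h (frac_kernel a l h)%:E <= (c + c)%:E)%E.
Proof.
have mk : measurable_fun setT (fun h => (frac_kernel a l h)%:E).
  by apply/measurable_EFinP; exact: measurable_frac_kernelr.
have k0 h : (0 <= (frac_kernel a l h)%:E)%E by rewrite lee_fin frac_kernel_ge0.
move=> lec.
rewrite -(setUv `]-oo, 0%R]%classic) setCitvl ge0_integral_setU//; last 2 first.
- by rewrite -setCitvl setUv.
- by rewrite -setCitvl; exact/disj_setPCl.
rewrite EFinD leeD//; apply: le_trans lec.
(* The endpoint 0 is Lebesgue-null, so the two half-lines can be matched by the substitution of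
   [- h] for [h]; the kernel is even in [h]. *)
rewrite integral_itv_obnd_cbnd; last exact: measurable_funTS.
rewrite ge0_integration_by_substitution0//.
by under [leRHS]eq_integral do rewrite frac_kernelN.
Qed.

(** The exponent is kept in the form [q - 1] with [q = 2 - 2 a], positive when [a < 1], to match
    [integral_powR_near0_le]. *)
Lemma frac_kernel_le_near0 a l h : 0 < h ->
  frac_kernel a l h <= l ^+ 2 * h `^ (2 - 2 * a - 1).
Proof.
move=> h0; rewrite /frac_kernel gtr0_norm//.
rewrite (_ : 2 - 2 * a - 1 = 2 - (1 + 2 * a)); last by ring.
rewrite powRB ?(gt_eqF h0) ?implybT// powR_mulrn ?(ltW h0)// mulrA.
by rewrite ler_wpM2r ?invr_ge0 ?powR_ge0// -exprMn onem_cos_le_sqr.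
Qed.

(** Here the exponent has the form [- q - 1] with [q = 2 a], to match [integral_powR_tail_le]. *)
Lemma frac_kernel_le_tail a l h : 0 < h ->
  frac_kernel a l h <= 2 * h `^ (- (2 * a) - 1).
Proof.
move=> h0; rewrite /frac_kernel gtr0_norm//.
rewrite (_ : - (2 * a) - 1 = - (1 + 2 * a)); last by ring.
by rewrite powRN ler_wpM2r ?invr_ge0 ?powR_ge0// onem_cos_le2.
Qed.

(* The two regimes [1 - cos x <= x ^ 2] and [1 - cos x <= 2] are glued at [h = 1 / |l|]. *)
Lemma integral_frac_kernel_le a l : 0 < a < 1 ->
  (\int[mu]_h (frac_kernel a l h)%:E <=
    (2 * ((2 - 2 * a)^-1 + a^-1) * `|l| `^ (2 * a))%:E)%E.
Proof.
move=> /andP[a0 a1].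
have [->|l0] := eqVneq l 0.
  rewrite integral0_eq => [|h _]; last first.
    by rewrite /frac_kernel mul0r cos0 subrr mul0r.
  rewrite lee_fin mulr_ge0 ?powR_ge0// mulr_ge0// addr_ge0// invr_ge0; lra.
(* The kernel depends on [l] only through [|l|], which is now renamed [l] and is positive. *)
under eq_integral do rewrite -frac_kernel_norm.
have {l0} : 0 < `|l| by rewrite normr_gt0.
have [m ->] : exists m : R, `|l| = m by exists `|l|.
move: m => {}l l0.
have c0 : 0 < l^-1 by rewrite invr_gt0.
have q0 : 0 < 2 - 2 * a by lra.
have p0 : 0 < 2 * a by lra.
have mk : measurable_fun setT (fun h => (frac_kernel a l h)%:E).
  by apply/measurable_EFinP; exact: measurable_frac_kernelr.
rewrite (_ : 2 * (_ + _) * _ = ((2 - 2 * a)^-1 + a^-1) * l `^ (2 * a) +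
  ((2 - 2 * a)^-1 + a^-1) * l `^ (2 * a)); last by ring.
apply: integral_frac_kernel_le_half.
rewrite (@itv_bndbnd_setU _ _ _ (BRight l^-1))//; last first.
  by rewrite bnd_simp ltW.
rewrite ge0_integral_setU//; last 3 first.
- exact: measurable_funTS.
- by move=> h _; rewrite lee_fin frac_kernel_ge0.
- rewrite disj_set2E; apply/eqP/seteqP; split => // h/= [].
  by rewrite !in_itv/= => /andP[_ hl]; rewrite andbT ltNge hl.
(* On []0, 1/l]] the bound is [l^2 * (1/l)^(2 - 2a) / (2 - 2a) = l^(2a) / (2 - 2a)]; on the tail it
   is [2 * l^(2a) / (2a) = l^(2a) / a]. *)
rewrite mulrDl EFinD leeD//.
- have mp : measurable_fun (`]0%R, l^-1]%classic : set R)
      (fun h : R => (h `^ (2 - 2 * a - 1))%:E).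
    by apply: measurable_funTS; apply/measurable_EFinP.
    apply: (@le_trans _ _ (\int[mu]_(h in `]0%R, (l^-1)%R])
      ((l ^+ 2)%:E * (h `^ (2 - 2 * a - 1))%:E)%E)%E).
    apply: ge0_le_integral => //.
    + by move=> h _; rewrite lee_fin frac_kernel_ge0.
    + exact: measurable_funTS.
    + exact: measurable_funeM.
    + move=> h /=; rewrite in_itv/= => /andP[h0 _].
      by rewrite -EFinM lee_fin frac_kernel_le_near0.
  rewrite ge0_integralZl//; last 2 first.
  + by move=> h _; rewrite lee_fin powR_ge0.
  + by rewrite lee_fin sqr_ge0.
  apply: (le_trans (lee_wpmul2l _ (integral_powR_near0_le _ _ c0 q0))).
    by rewrite lee_fin sqr_ge0.
  rewrite -EFinM lee_fin mulrA [X in X <= _]mulrC ler_wpM2l ?invr_ge0 ?(ltW q0)//.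
  rewrite -powR_inv1 ?(ltW l0)// -powRrM -powR_mulrn ?(ltW l0)//.
  rewrite -powRD ?(gt_eqF l0) ?implybT//.
  by rewrite (_ : 2%:R + _ = 2 * a)//; ring.
- rewrite integral_itv_obnd_cbnd; last exact: measurable_funTS.
  have mp : measurable_fun (`[l^-1, +oo[%classic : set R)
      (fun h : R => (h `^ (- (2 * a) - 1))%:E).
    by apply: measurable_funTS; apply/measurable_EFinP.
  apply: (@le_trans _ _ (\int[mu]_(h in `[(l^-1)%R, +oo[)
      (2%:E * (h `^ (- (2 * a) - 1))%:E)%E)%E).
    apply: ge0_le_integral => //.
    + by move=> h _; rewrite lee_fin frac_kernel_ge0.
    + exact: measurable_funTS.
    + exact: measurable_funeM.
    + move=> h /=; rewrite in_itv/= => /andP[h0 _].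
      by rewrite -EFinM lee_fin frac_kernel_le_tail// (lt_le_trans c0).
  rewrite ge0_integralZl//; last by move=> h _; rewrite lee_fin powR_ge0.
  apply: (le_trans (lee_wpmul2l _ (integral_powR_tail_le _ _ c0 p0))) => //.
  rewrite -EFinM lee_fin -powR_inv1 ?(ltW l0)// -powRrM mulN1r opprK.
  by rewrite le_eqVlt; apply/orP; left; apply/eqP; field; rewrite gt_eqF.
Qed.

(** For [l > 0], keep only [h] in [[1/(2l), 1/l]]. There [l h] lies in [[1/2, 1]], so the numerator
    is at least [1 - cos (1/2)], and the weight is at least [l^(1 + 2a)]. The interval has length
    [1/(2l)], whence the factor 1/2 and the exponent [2a]. *)
Lemma integral_frac_kernel_ge a l : 0 < a < 1 ->
  (((1 - cos (2^-1 : R)) / 2 * `|l| `^ (2 * a))%:E <=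
   \int[mu]_h (frac_kernel a l h)%:E)%E.
Proof.
move=> /andP[a0 a1].
have [->|l0] := eqVneq l 0.
  rewrite normr0 powR0 ?mulf_neq0 ?(gt_eqF a0)// mulr0 integral_ge0// => h _.
  by rewrite lee_fin frac_kernel_ge0.
under eq_integral do rewrite -frac_kernel_norm.
have {l0} : 0 < `|l| by rewrite normr_gt0.
have [m ->] : exists m : R, `|l| = m by exists `|l|.
move: m => {}l l0.
have k0 h : (0 <= (frac_kernel a l h)%:E)%E by rewrite lee_fin frac_kernel_ge0.
have mk : measurable_fun setT (fun h => (frac_kernel a l h)%:E).
  by apply/measurable_EFinP; exact: measurable_frac_kernelr.
apply: (@le_trans _ _ (\int[mu]_(h in `[(2^-1 / l)%R, (l^-1)%R]) (frac_kernel a l h)%:E)%E);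
  last exact: ge0_subset_integral.
apply: (@le_trans _ _ (\int[mu]_(h in `[(2^-1 / l)%R, (l^-1)%R])
    (cst ((1 - cos (2^-1 : R)) * l `^ (1 + 2 * a))%:E h))%E).
  rewrite integral_cst//= lebesgue_measure_itv/= lte_fin.
  rewrite gtr_pMl ?invr_gt0// (_ : 2^-1 < 1 = true); last by apply/idP; lra.
  rewrite -EFinB -EFinM lee_fin powRD ?(gt_eqF l0) ?implybT// powRr1 ?(ltW l0)//.
  by rewrite le_eqVlt; apply/orP; left; apply/eqP; field; rewrite gt_eqF.
apply: ge0_le_integral => //.
- by move=> h _; rewrite lee_fin mulr_ge0 ?powR_ge0 ?onem_cos_ge0.
- exact: measurable_funTS.
move=> h /=; rewrite in_itv/= => /andP[h1 h2].
have h0 : 0 < h by rewrite (lt_le_trans _ h1)// divr_gt0.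
rewrite lee_fin ler_pM ?onem_cos_ge0 ?powR_ge0//.
  rewrite onem_cos_ge// -ler_pdivrMl// mulrC h1/=.
  by rewrite -ler_pdivlMl// mulr1.
(* Writing [l^(1 + 2a)] as the inverse of [(1/l)^(1 + 2a)] reduces the claim to monotonicity of the
   power at [h <= 1/l]. *)
rewrite (gtr0_norm h0) -powRN -[in leLHS](invrK l) -powR_inv1 ?invr_ge0 ?(ltW l0)//.
rewrite -powRrM mulN1r !powRN lef_pV2 ?posrE ?powR_gt0 ?invr_gt0//.
by rewrite ge0_ler_powR ?nnegrE ?invr_ge0 ?(ltW l0) ?(ltW h0)//; lra.
Qed.

End fractional_kernel.

(** * Covariance increments as integrals against the spectral measure *)

Section spectral_measure.
Context {R : realType} (mu : {finite_measure set R -> \bar R}).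

Lemma finite_measure_bounded_integrable (f : R -> R) (M : R) :
  measurable_fun setT f -> (forall x, `|f x| <= M) ->
  mu.-integrable setT (EFin \o f).
Proof.
move=> mf fM; apply: measurable_bounded_integrable => //.
  by rewrite -ge0_fin_numE// fin_num_measure.
exists M; split; first exact: num_real.
by move=> y My x _; exact: (le_trans (fM x) (ltW My)).
Qed.

Lemma measurable_cosM (t : R) : measurable_fun setT (fun l : R => cos (l * t)).
Proof.
apply: (measurableT_comp (continuous_measurable_fun (@continuous_cos R))).
exact: measurable_funM.
Qed.

Lemma measurable_sinM (t : R) : measurable_fun setT (fun l : R => sin (l * t)).
Proof.
apply: (measurableT_comp (continuous_measurable_fun (@continuous_sin R))).
exact: measurable_funM.
Qed.

Lemma integrable_cosM (t : R) : mu.-integrable setT (fun l : R => (cos (l * t))%:E).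
Proof.
apply: (finite_measure_bounded_integrable _ 1 (measurable_cosM t)) => x.
exact: cos_max.
Qed.

Lemma integrable_sinM (t : R) : mu.-integrable setT (fun l : R => (sin (l * t))%:E).
Proof.
apply: (finite_measure_bounded_integrable _ 1 (measurable_sinM t)) => x.
exact: sin_max.
Qed.

(** The image of a set under negation is also its preimage, so symmetry says that [mu] equals its
    pushforward by negation; then change variables. *)
Lemma symmetric_measure_integralN (f : R -> \bar R) : symmetric_measure mu ->
  measurable_fun setT f -> mu.-integrable setT (f \o -%R) ->
  (\int[mu]_x f x = \int[mu]_x f (- x)%R)%E.
Proof.
move=> smu mf intf.
rewrite -(@integral_pushforward _ _ R R R -%R _ mu setT f)//.
apply: eq_measure_integral => A mA _; apply: (etrans (esym (smu A mA))).
congr (mu _); apply/seteqP; split => [_ [x Ax <-]/=|x Ax].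
  by rewrite /= opprK.
by exists (- x); rewrite ?opprK.
Qed.

(** [sin] is odd, so the integral equals its opposite; being finite, it is 0. *)
Lemma symmetric_measure_integral_sin (t : R) : symmetric_measure mu ->
  (\int[mu]_l (sin (l * t))%:E = 0)%E.
Proof.
move=> smu.
have iN : (\int[mu]_l (sin (l * t))%:E = - \int[mu]_l (sin (l * t))%:E)%E.
  rewrite {1}(symmetric_measure_integralN (fun l => (sin (l * t))%:E))//.
  - under eq_integral do rewrite mulNr sinN EFinN.
    by rewrite integralN// integrable_add_def// integrable_sinM.
  - by apply/measurable_EFinP; exact: measurable_sinM.
  - rewrite (_ : _ \o _ = (fun l : R => (sin (l * - t))%:E)).
      exact: integrable_sinM.
    by apply/funext => l/=; rewrite mulNr mulrN.
have := integrable_fin_num measurableT (integrable_sinM t).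
move: iN; case: (\int[mu]_l _)%E => //= r [rN] _.
by congr EFin; lra.
Qed.

Variables Rre Rim : R -> R.
Hypothesis spmu : spectral_measure_of mu Rre Rim.

Lemma spectral_increment (h : R) :
  ((Rre 0 - Rre h)%:E = \int[mu]_l (1 - cos (l * h))%:E)%E.
Proof.
rewrite EFinB (spmu 0).1 (spmu h).1 -integralB//; last 2 first.
- exact: integrable_cosM.
- exact: integrable_cosM.
by apply: eq_integral => l _; rewrite mulr0 cos0.
Qed.

(** The left side is the modulus of [R_X 0 - R_X h]. Symmetry kills the imaginary part, and the real
    part is an integral of [1 - cos >= 0]. *)
Lemma spectral_increment_norm (h : R) : symmetric_measure mu ->
  Num.sqrt ((Rre 0 - Rre h) ^+ 2 + (Rim 0 - Rim h) ^+ 2) = Rre 0 - Rre h.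
Proof.
move=> smu.
have Rim0 t : Rim t = 0.
  by apply: EFin_inj; rewrite (spmu t).2 symmetric_measure_integral_sin.
rewrite !Rim0 subrr expr0n addr0 sqrtr_sqr ger0_norm//.
rewrite -lee_fin spectral_increment; apply: integral_ge0 => l _.
by rewrite lee_fin onem_cos_ge0.
Qed.

Lemma spectral_increment_tonelli (a : R) :
  (\int[lebesgue_measure]_h ((Rre 0 - Rre h) / `|h| `^ (1 + 2 * a))%:E =
   \int[mu]_l \int[lebesgue_measure]_h (frac_kernel a l h)%:E)%E.
Proof.
have mk : measurable_fun setT (fun z : R * R => (frac_kernel a z.2 z.1)%:E).
  by apply/measurable_EFinP; exact: measurable_frac_kernel.
transitivity (\int[lebesgue_measure]_h \int[mu]_l (frac_kernel a l h)%:E)%E.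
  apply: eq_integral => h _.
  rewrite EFinM spectral_increment -ge0_integralZr//.
  apply/measurable_EFinP; apply: measurable_funB => //.
  exact: measurable_cosM.
exact: (@fubini_tonelli _ _ _ _ R lebesgue_measure mu
  (fun z : R * R => (frac_kernel a z.2 z.1)%:E) mk
  (fun z => frac_kernel_ge0 a z.2 z.1)).
Qed.

End spectral_measure.

(** * Equivalence of the spectral moment condition and the covariance condition *)

Theorem mainTheorem6 (d : measure_display) (Omega : measurableType d)
  (R : realType) (P : probability Omega R)
  (Xre Xim : R -> Omega -> R) (Rre Rim : R -> R)
  (mu : {finite_measure set R -> \bar R}) (alpha : R) :
  wss_process P Xre Xim Rre Rim ->
  spectral_measure_of mu Rre Rim ->
  symmetric_measure mu ->
  0 < alpha < 1 ->
  ((\int[mu]_(l in setT) (`|l| `^ (2 * alpha))%:E < +oo)%E <->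
   (\int[lebesgue_measure]_(h in setT)
      (Num.sqrt ((Rre 0 - Rre h) ^+ 2 + (Rim 0 - Rim h) ^+ 2)
         / `|h| `^ (1 + 2 * alpha))%:E < +oo)%E).
Proof.
move=> _ spmu smu a01.
have mp : measurable_fun setT (fun l : R => (`|l| `^ (2 * alpha))%:E).
  apply/measurable_EFinP.
  exact: (measurableT_comp (@measurable_powR R (2 * alpha))).
(* Measurability of [K], needed to integrate the pointwise bounds against [mu]. *)
have mK : measurable_fun setT
    (fun l : R => (\int[lebesgue_measure]_h (frac_kernel alpha l h)%:E)%E).
  apply: (@measurable_fun_fubini_tonelli_G _ _ _ _ R lebesgue_measure
    (fun z : R * R => (frac_kernel alpha z.2 z.1)%:E)).
  - by apply/measurable_EFinP; exact: measurable_frac_kernel.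
  - by move=> z; rewrite lee_fin frac_kernel_ge0.
have K0 (l : R) : (0 <= \int[lebesgue_measure]_h (frac_kernel alpha l h)%:E)%E.
  by apply: integral_ge0 => h _; rewrite lee_fin frac_kernel_ge0.
under [X in _ <-> (X < _)%E]eq_integral do rewrite (spectral_increment_norm _ _ _ spmu _ smu).
rewrite (spectral_increment_tonelli _ _ _ spmu).
split => [fin|].
(* From (i) to (ii): [C] is the constant of the upper bound on [K]. *)
- set C := 2 * ((2 - 2 * alpha)^-1 + alpha^-1).
  have C0 : 0 <= C.
    by rewrite mulr_ge0// addr_ge0// invr_ge0; lra.
  apply: (@le_lt_trans _ _ (\int[mu]_l (C%:E * (`|l| `^ (2 * alpha))%:E))%E).
    apply: ge0_le_integral => //; first exact: measurable_funeM.
    by move=> l _; exact: integral_frac_kernel_le.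
  rewrite ge0_integralZl//.
  by rewrite lte_mul_pinfty.
(* From (ii) to (i): [c] is the constant of the lower bound on [K]. *)
- set c := (1 - cos (2^-1 : R)) / 2.
  have c0 : 0 < c by rewrite divr_gt0// onem_cos_half_gt0.
  move=> fin.
  have : (\int[mu]_l (c%:E * (`|l| `^ (2 * alpha))%:E) < +oo)%E.
    apply: le_lt_trans fin.
    apply: ge0_le_integral => //.
    + by move=> l _; rewrite -EFinM lee_fin mulr_ge0 ?powR_ge0// ltW.
    + exact: measurable_funeM.
    + by move=> l _; exact: integral_frac_kernel_ge.
  rewrite ge0_integralZl//; last by rewrite lee_fin ltW.
  (* Strict positivity of [c] matters here: an infinite moment would make [c] times it infinite as
     well. *)
  by case: (\int[mu]_x _)%E => [r| |]//; rewrite ?ltry// gt0_muley// lte_fin.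
Qed.
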